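(* Let $p\in\mathbf N$ and let $\mathbf p=(\tfrac1p,\ldots,\tfrac1p)$ (with $p$ components). Suppose $A$ is an $N\times N$ stochastic matrix such that the one-sided Markov shift $X_A^-$ is a $\mathbf p$-endomorphism and is strongly mixing. Then $X_A^-$ is tvwB.
   Context: **Measure-preserving systems.** A measure-preserving system (m.p.s.) is a quadruple $(X,\mathcal B,\mu,T)$ where $X$ is a compact metric space with Borel $\sigma$-algebra $\mathcal B$, $(X,\mathcal B,\mu)$ is a nonatomic Lebesgue probability space (isomorphic to $[0,1]$ with Lebesgue measure), and $T:X\to X$ is measurable with $\mu(T^{-1}B)=\mu(B)$ for $B\in\mathcal B$. **$\mathbf p$-endomorphisms.** For a probability vector $\mathbf p=(p_1,\dots,p_s)$ with all $p_j>0$, let $h(\mathbf p)=-\sum_j p_j\log_2 p_j$. An m.p.s. $(X,\mathcal B,\mu,T)$ is a $\mathbf p$-endomorphism if $T$ is $s$-to-1 a.e., for a.a. $x$ the conditional probabilities (given $x$) of the $s$ preimages of $x$ under $T$ are the components of $\mathbf p$ (with multiplicity), and its entropy is $h(\mathbf p)$. **One-sided Markov shifts.** A square matrix $A$ with nonnegative entries is stochastic if each row sums to $1$; $|A|$ is its number of rows; it is irreducible if for each $(i,j)$ some $(A^k)_{ij}$, $k\in\mathbf N$, is nonzero. For irreducible $A$ let $\mathbf q$ be the unique positive row probability vector with $\mathbf qA=\mathbf q$. The one-sided Markov shift $X_A^-$ over $A$ is $\{1,\dots,|A|\}^{-\mathbf N}$ (left-infinite sequences $(\ldots,x_{-2},x_{-1})$)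 with the shift $T$, $(Tx)_{-n}=x_{-n-1}$, and the shift-invariant Borel measure $\mu$ determined by $\mu(x_{-n}=a_{-n},\dots,x_{-1}=a_{-1})=q_{a_{-n}}A_{a_{-n}a_{-(n-1)}}\cdots A_{a_{-2}a_{-1}}$. **Trees.** $\mathcal T$ is the set of all finite sequences (nodes) of elements of $\{1,\dots,s\}$, including the empty one; $|v|$ is the length of $v$; $\mathcal T'$ is the set of nonempty nodes; $\mathcal T_N=\{v:|v|\le N\}$, $\mathcal T_N'=\{v:0<|v|\le N\}$. $\sigma:\mathcal T'\to\mathcal T$ deletes the leftmost symbol. The weight of $v=(a_1,\dots,a_j)$ is $w_v=\prod_i p_{a_i}$ (and $1$ for the empty node). A tree automorphism is a bijection $B:\mathcal T\to\mathcal T$ with $B\sigma(v)=\sigma B(v)$ and $w_{Bv}=w_v$ for all $v\in\mathcal T'$; $\mathcal A_N$ is the set of restrictions of tree automorphisms to $\mathcal T_N$. For a compact metric space $(R,d)$ and functions $h,h'$ into $R$ defined on $\mathcal T_N'$ (or on $\mathcal T'$), $$\bar t_N(h,h')=\frac1N\inf_{B\in\mathcal A_N}\sum_{0<|v|\le N}w_v\,d(h(v),h'(Bv)).$$ **Tree names.** A tree partition of a $\mathbf p$-endomorphism is a measurable $K:X\to\{1,\dots,s\}$ such that for a.a. $x$ the $s$ preimages of $x$ have distinct $K$-values and the preimage with $K$-value $j$ has conditional probability $p_j$. Fix one. For $j\in\{1,\dots,s\}$, $T_jx$ is the preimage of $x$ with $K$-value $j$; for $v=(a_1,\dots,a_n)$,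 $T_vx=T_{a_1}(T_{a_2}\cdots(T_{a_n}x)\cdots)$. For $g:X\to R$ the $g$-tree name of $x$ is $\tau_x^g:\mathcal T'\to R$, $\tau_x^g(v)=g(T_vx)$. **tvwB.** For a $\mathbf p$-endomorphism $\mathbf X$ and a measurable $g:X\to R$ into a compact metric space, $(\mathbf X,g)$ is tvwB (tree very weak Bernoulli) if for every $\varepsilon>0$ there is $N$ such that for every $n\ge N$ there is a set $G\subseteq X$ of measure at least $1-\varepsilon$ with $\bar t_n(\tau_x^g,\tau_y^g)<\varepsilon$ for all $x,y\in G$ (independent of the choice of $K$). $\mathbf X$ is tvwB if $(\mathbf X,g)$ is tvwB for every compact metric space $R$ and every measurable $g:X\to R$. *)

(* Defs.v *)
From HB Require Import structures.
From mathcomp Require Import all_boot all_order all_algebra.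
From mathcomp Require Import all_classical all_reals all_analysis.

Set Implicit Arguments.
Unset Strict Implicit.
Unset Printing Implicit Defensive.

Import Order.TTheory GRing.Theory Num.Theory.
Import numFieldNormedType.Exports.

Local Open Scope classical_set_scope.
Local Open Scope ring_scope.

Notation borel X := (g_sigma_algebraType (@open X)).

Section MeasurePreservingSystems.
Context {R : realType}.

Definition metrizable (X : topologicalType) : Prop :=
  exists d : X -> X -> R,
    [/\ (forall x y, d x y = 0 <-> x = y),
        (forall x y, d x y = d y x),
        (forall x y z, d x z <= d x y + d y z) &
        (forall x (U : set X),
           nbhs x U <-> exists2 e : R, 0 < e & [set y | d x y < e] `<=` U)].

(* Isomorphism modulo null sets: [f] and [g] are mutually inverse,
   bimeasurable and measure preserving between a full-measure set [A] and a
   full-measure subset [B] of the unit interval. *)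
Definition lebesgue_space d (X : measurableType d) (mu : probability X R) :
    Prop :=
  exists (A : set X) (B : set R) (f : X -> R) (g : R -> X),
    [/\ measurable A /\ mu A = 1%E,
        [/\ measurable B, B `<=` `[0, 1] &
            lebesgue_measure (`[0, 1] `\` B) = 0%E],
        measurable_fun A f /\ measurable_fun B g,
        [/\ (forall x, A x -> B (f x)), (forall y, B y -> A (g y)),
            (forall x, A x -> g (f x) = x) & (forall y, B y -> f (g y) = y)] &
        (forall C : set R, measurable C -> C `<=` B ->
           mu (A `&` f @^-1` C) = lebesgue_measure C)].

Definition mps (X : ptopologicalType) (mu : probability (borel X) R)
    (T : borel X -> borel X) : Prop :=
  [/\ compact [set: X], metrizable X, lebesgue_space mu,
      measurable_fun [set: borel X] T &
      (forall B : set (borel X), measurable B -> mu (T @^-1` B) = mu B)].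

Definition strongly_mixing d (X : measurableType d) (mu : probability X R)
    (T : X -> X) : Prop :=
  forall A B : set X, measurable A -> measurable B ->
    (mu (iter n T @^-1` A `&` B) @[n --> \oo] --> mu A * mu B)%E.

End MeasurePreservingSystems.

Section Entropy.
Context {R : realType}.

Definition log2 (x : R) : R := ln x / ln 2.

Definition vec_entropy (s : nat) (p : 'I_s -> R) : R :=
  - \sum_(j < s) p j * log2 (p j).

Context d (X : measurableType d) (mu : probability X R) (T : X -> X).

(* A finite partition is given by its labelling function.  A cell of measure
   zero contributes 0, as [ln 0 = 0]. *)
Definition part_entropy (F : finType) (f : X -> F) : R :=
  - \sum_(a : F) fine (mu (f @^-1` [set a])) * log2 (fine (mu (f @^-1` [set a]))).

Definition itinerary (m : nat) (f : X -> 'I_m) (n : nat) (x : X) :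
    {ffun 'I_n -> 'I_m} := [ffun i : 'I_n => f (iter i T x)].

Definition entropy_rate (m : nat) (f : X -> 'I_m) : R :=
  lim ((part_entropy (itinerary f n) / n%:R) @[n --> \oo]).

Definition measurable_label (m : nat) (f : X -> 'I_m) : Prop :=
  forall j, measurable (f @^-1` [set j]).

Definition ks_entropy : \bar R :=
  ereal_sup [set h | exists (m : nat) (f : X -> 'I_m),
                       measurable_label f /\ h = (entropy_rate f)%:E].

End Entropy.

Section PEndomorphisms.
Context {R : realType}.

Section Fibres.
Context d (X : measurableType d) (mu : probability X R) (T : X -> X).

(* [k x] is the conditional probability on the fibre of [T] over [x].  The
   integral is against the law of [T], which is [mu] since [T] preserves
   [mu]. *)
Definition fibre_probability (k : R.-pker X ~> X) : Prop :=
  forall B C : set X, measurable B -> measurable C ->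
    (mu (B `&` T @^-1` C) = \int[mu]_(x in C) k x B)%E.

Context (s : nat) (p : 'I_s -> R).

(* [e] lists, without repetition, the preimages of [x] lying in [X0], and the
   [j]-th one has conditional probability [p j]. *)
Definition fibre_listing (X0 : set X) (k : R.-pker X ~> X) (x : X)
    (e : 'I_s -> X) : Prop :=
  [/\ injective e, range e = X0 `&` T @^-1` [set x] &
      forall j, k x [set e j] = (p j)%:E].

(* Being [s]-to-1 almost everywhere is understood modulo null sets: only the
   preimages in some set [X0] of full measure are counted.  This matters for
   one-sided Markov shifts, where every point has as many preimages in the
   whole sequence space as there are states, but those involving a transition
   of probability 0 form a null set. *)
Definition p_to_one : Prop :=
  exists (X0 : set X) (k : R.-pker X ~> X),
    [/\ measurable X0, mu X0 = 1%E, fibre_probability k &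
        {ae mu, forall x, exists e, fibre_listing X0 k x e}].

(* [K] is a tree partition with inverse branches [br]: for almost every [x],
   [br j x] is the preimage of [x] with [K]-value [j].  The branches are thus
   determined by [K] almost everywhere. *)
Definition tree_partition (K : X -> 'I_s) (br : 'I_s -> X -> X) : Prop :=
  measurable_label K /\
  exists (X0 : set X) (k : R.-pker X ~> X),
    [/\ measurable X0, mu X0 = 1%E, fibre_probability k &
        {ae mu, forall x, fibre_listing X0 k x (br^~ x) /\
                          forall j, K (br j x) = j}].

End Fibres.

Definition p_endomorphism (X : ptopologicalType) (mu : probability (borel X) R)
    (T : borel X -> borel X) (s : nat) (p : 'I_s -> R) : Prop :=
  [/\ mps mu T, p_to_one mu T p & ks_entropy mu T = (vec_entropy p)%:E].

End PEndomorphisms.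

Section Trees.
Context {R : realType} (s : nat) (p : 'I_s -> R).

Definition weight (v : seq 'I_s) : R := \prod_(a <- v) p a.

(* [behead] is the parent map deleting the leftmost symbol. *)
Definition tree_automorphism (B : seq 'I_s -> seq 'I_s) : Prop :=
  bijective B /\
  forall v, v != [::] -> B (behead v) = behead (B v) /\ weight (B v) = weight v.

(* The infimum over restrictions of tree automorphisms to depth [N] is taken
   over the automorphisms themselves: the sum only depends on the restriction.
   Values of [h] and [h'] at the empty node are never used. *)
Definition tbar (M : metricType R) (N : nat) (h h' : seq 'I_s -> M) : R :=
  N%:R^-1 * inf [set r | exists2 B, tree_automorphism B &
    r = \sum_(1 <= n < N.+1) \sum_(v : n.-tuple 'I_s)
          weight v * mdist (h v) (h' (B v))].

Definition tree_name (X M : Type) (br : 'I_s -> X -> X) (g : X -> M) (x : X)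
    (v : seq 'I_s) : M := g (foldr br x v).

End Trees.

Section TreeVeryWeakBernoulli.
Context {R : realType} d (X : measurableType d) (mu : probability X R).
Context (T : X -> X) (s : nat) (p : 'I_s -> R).

(* The notion does not depend on the tree partition: one is required to exist,
   and the condition is imposed for all of them. *)
Definition tvwB_fun (M : metricType R) (g : X -> M) : Prop :=
  (exists K br, tree_partition mu T p K br) /\
  forall K br, tree_partition mu T p K br ->
  forall eps : R, 0 < eps ->
  exists N : nat, forall n : nat, (N <= n)%N ->
  exists G : set X, [/\ measurable G, ((1 - eps)%:E <= mu G)%E &
    forall x y, G x -> G y -> tbar p n (tree_name br g x) (tree_name br g y) < eps].

Definition tvwB : Prop :=
  forall (M : metricType R) (g : X -> M), compact [set: M] ->
    (forall U : set M, open U -> measurable (g @^-1` U)) -> tvwB_fun g.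

End TreeVeryWeakBernoulli.

(* A left-infinite sequence [(..., x_{-2}, x_{-1})] is encoded by
   [n |-> x_{-(n+1)}]. *)
Definition past_seq (N : nat) : Type := {ptws nat -> discrete_topology 'I_N.+1}.

HB.instance Definition _ (N : nat) := Topological.copy (past_seq N)
  {ptws nat -> discrete_topology 'I_N.+1}.
HB.instance Definition _ (N : nat) :=
  isPointed.Build (past_seq N) (fun _ => ord0).

Definition past_shift (N : nat) (x : borel (past_seq N)) : borel (past_seq N) :=
  fun n => x n.+1.

Section MarkovShifts.
Context {R : realType} (N : nat).

Definition stochastic (A : 'M[R]_N.+1) : Prop :=
  (forall i j, 0 <= A i j) /\ (forall i, \sum_j A i j = 1).

Definition irreducible_matrix (A : 'M[R]_N.+1) : Prop :=
  forall i j, exists2 k : nat, (0 < k)%N & (A ^+ k) i j != 0.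

Definition stationary_vector (A : 'M[R]_N.+1) (q : 'rV[R]_N.+1) : Prop :=
  [/\ (forall j, 0 < q 0 j), \sum_j q 0 j = 1 & q *m A = q].

(* With the encoding of [past_seq], the word [a_{-(n+1)} ... a_{-1}] is
   [a n, ..., a 0]. *)
Definition markov_measure (A : 'M[R]_N.+1)
    (mu : probability (borel (past_seq N)) R) : Prop :=
  exists2 q, stationary_vector A q &
    forall (n : nat) (a : nat -> 'I_N.+1),
      mu [set x | forall i, (i <= n)%N -> x i = a i] =
      (q 0 (a n) * \prod_(i < n) A (a i.+1) (a i))%:E.

End MarkovShifts.

(* Main.v *)
Require Import Defs.
From HB Require Import structures.
From mathcomp Require Import all_boot all_order all_algebra.
From mathcomp Require Import all_classical all_reals all_analysis.
From mathcomp Require Import perm measurable_realfun finmap zify ring lra.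

(** By the Markov property the preimages of x are the sequences b :: x with
  A (x 0) b = 1/p, so the tree of states over x depends only on x 0 and each
  of its nodes has p children with distinct states.  Mixing gives K such that
  the trees over any two points carry a common word at depth K.  A tree
  automorphism is built greedily from the root: a pair of nodes with equal
  words has its children matched exactly, and any other pair has its children
  matched so that one child pair comes closer to a common word.  A bounded
  potential shows that the proportions of unmatched nodes of the levels have a
  sum bounded independently of the two points.  A measurable g into a compact
  metric space is, off a set E of small measure, nearly a function of finitely
  many coordinates.  Since the p^n preimages of order n are equiprobable,
  Markov's inequality shows that for most x few nodes of the tree lie in E. *)

Set Implicit Arguments.
Unset Strict Implicit.
Unset Printing Implicit Defensive.

Import Order.TTheory GRing.Theory Num.Theory.
Import numFieldNormedType.Exports.

Local Open Scope classical_set_scope.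
Local Open Scope ring_scope.

(** * Greedy matching of two labelled [p]-ary trees *)

Section Matching.
Variables (R : realType) (p : nat).
Hypothesis p_gt0 : (0 < p)%N.

(** The permutation of the children of [u] may depend on [u] and on its image [B u], which is
    already known when the tree is descended from the root. The greedy construction needs both. *)
Definition twist (pi : seq 'I_p -> seq 'I_p -> 'S_p) : seq 'I_p -> seq 'I_p :=
  fix B v := if v is j :: u then pi u (B u) j :: B u else [::].

Lemma size_twist pi v : size (twist pi v) = size v.
Proof. by elim: v => //= j v ->. Qed.

Lemma twist_inj pi : injective (twist pi).
Proof.
elim=> [|j u IH] [|j' u'] //= [Ej /IH Eu].
by move: Ej; rewrite Eu => /perm_inj ->.
Qed.

(** Surjectivity comes from the inverse permutations, applied level by level. Weights are preserved
    because with equal probabilities they depend only on the length. *)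
Lemma twist_automorphism pi :
  tree_automorphism (fun _ : 'I_p => p%:R^-1 : R) (twist pi).
Proof.
split.
  pose fix C v := if v is j :: u then ((pi (C u) u)^-1)%g j :: C u else [::].
  have CK : cancel C (twist pi).
    by elim=> //= j u ->; rewrite permKV.
  by exists C => // v; apply: (@twist_inj pi); rewrite CK.
case=> // j u _; split=> //.
by rewrite /weight !big_const_seq !count_predT size_twist.
Qed.

Lemma weight_unif (v : seq 'I_p) :
  weight (fun=> p%:R^-1 : R) v = p%:R^-1 ^+ size v.
Proof.
by rewrite /weight big_const_seq count_predT iter_mulr_1.
Qed.

Lemma sum_tuple_cons (V : nmodType) (F : seq 'I_p -> V) m :
  \sum_(v : m.+1.-tuple 'I_p) F v =
  \sum_(v : m.-tuple 'I_p) \sum_(j < p) F (j :: v).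
Proof.
rewrite exchange_big pair_big /=.
rewrite (reindex (fun u : 'I_p * m.-tuple 'I_p => cons_tuple u.1 u.2)) //=.
exists (fun v : m.+1.-tuple 'I_p => (thead v, [tuple of behead v])).
  by move=> [j v] _; congr pair; exact: val_inj.
by move=> v _; rewrite [RHS]tuple_eta; exact: val_inj.
Qed.

Lemma sum_tuple_twist (V : nmodType) (F : seq 'I_p -> V) pi m :
  \sum_(v : m.-tuple 'I_p) F (twist pi v) = \sum_(v : m.-tuple 'I_p) F v.
Proof.
have szB (v : m.-tuple 'I_p) : size (twist pi v) == m.
  by rewrite size_twist size_tuple.
rewrite [RHS](reindex_inj (h := fun v => Tuple (szB v))) //.
by move=> u v [] /twist_inj /val_inj.
Qed.

(* [W r = toll K - toll (K - r)] is the potential of a pair of nodes at distance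
  [r] from a common label.  For [r > 0] the average of [W] over the [p] child
  pairs must be at most [W r - 1], although [p - 1] of them may be at distance
  [K]; this amounts to [W K - W (r - 1) >= p * (W K - W r + 1)]. *)
Fixpoint toll n := if n is n'.+1 then (p * (toll n').+1)%N else 0%N.

Lemma toll_homo : {homo toll : m n / (m <= n)%N}.
Proof.
apply: homo_leq => // [|n]; first exact: leq_trans.
by elim: n => //= n IH; rewrite leq_pmul2l // ltnS.
Qed.

Variables (S : eqType) (tau tau' : seq 'I_p -> S) (K : nat).
Hypothesis merge : forall v v', exists u u',
  [/\ size u = K, size u' = K & tau (u ++ v) = tau' (u' ++ v')].
Hypothesis siblings : forall v v', tau v = tau' v' ->
  exists pi : 'S_p, forall j, tau (j :: v) = tau' (pi j :: v').

Let near n v v' := `[< exists u u',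
  [/\ size u = n, size u' = n & tau (u ++ v) = tau' (u' ++ v')] >].

Let near_ex v v' : exists n, near n v v'.
Proof. by exists K; apply/asboolP. Qed.

(** The least number of levels to descend from [v] and from [v'] to meet a common label; [merge]
    bounds it by [K]. *)
Let dist v v' := ex_minn (near_ex v v').

Let dist_le v v' : (dist v v' <= K)%N.
Proof. by rewrite /dist; case: ex_minnP => n _; apply; apply/asboolP. Qed.

Let dist_eq0 v v' : (dist v v' == 0%N) = (tau v == tau' v').
Proof.
rewrite /dist; case: ex_minnP => n /asboolP[u [u' [su su' E]]] nmin.
apply/eqP/eqP => [n0|E0].
  by move: su su' E; rewrite n0 => /size0nil -> /size0nil ->.
apply/eqP; rewrite -leqn0; apply: nmin; apply/asboolP.
by exists [::], [::].
Qed.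

(** Nodes grow on the left, so the last symbols [j] and [j'] of two shortest words leading to a
    common label name the first children on the way. The transposition of [j] and [j'] pairs these
    two children, and their distance has dropped. *)
Let step v v' : exists pi : 'S_p,
  if tau v == tau' v' then forall j, tau (j :: v) = tau' (pi j :: v')
  else exists j, (dist (j :: v) (pi j :: v') < dist v v')%N.
Proof.
case: eqVneq => [/siblings //|]; rewrite -dist_eq0 {1 3}/dist.
case: ex_minnP => -[//|n] /asboolP[u [u' [su su' E]]] _ _.
move: su su' E; case/lastP: u => // u j; case/lastP: u' => // u' j'.
rewrite !size_rcons !cat_rcons => -[su] [su'] E.
exists (tperm j j'); exists j; rewrite tpermL ltnS /dist.
by case: ex_minnP => k _; apply; apply/asboolP; exists u, u'.
Qed.

Let pot v v' := (toll K - toll (K - dist v v'))%N.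

(** One-step drift: averaged over the children, the potential falls by at least 1 at a mismatched
    pair, and it vanishes on all children of a matched pair. *)
Let sum_pot pi v v' :
  (if tau v == tau' v' then forall j, tau (j :: v) = tau' (pi j :: v')
   else exists j, (dist (j :: v) (pi j :: v') < dist v v')%N) ->
  (\sum_(j < p) pot (j :: v) (pi j :: v') + p * (tau v != tau' v') <=
   p * pot v v')%N.
Proof.
case: eqVneq => [E Hpi|NE [j Hj]].
  rewrite big1 => [|j _]; first by rewrite muln0.
  rewrite /pot; have /eqP -> : dist (j :: v) (pi j :: v') == 0%N.
    by rewrite dist_eq0 Hpi.
  by rewrite subn0 subnn.
rewrite (bigD1 j) //= muln1.
set r := dist v v' in Hj *; set r' := dist (j :: v) _ in Hj *.
have rK : (r <= K)%N by exact: dist_le.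
(* As [r' < r], the closer child saves at least [toll (K - r).+1], which is [p * (toll (K - r)).+1].
   This pays for the other [p - 1] children, whose potential may be as large as [toll K]. *)
have potj : (pot (j :: v) (pi j :: v') + p * (toll (K - r)).+1 <= toll K)%N.
  rewrite /pot -/r'; have : (toll (K - r).+1 <= toll (K - r'))%N.
    by apply: toll_homo; lia.
  have := toll_homo (leq_subr r' K); rewrite /=; lia.
have others :
    (\sum_(i < p | i != j) pot (i :: v) (pi i :: v') <= p.-1 * toll K)%N.
  apply: (@leq_trans (\sum_(i < p | i != j) toll K)%N).
    by apply: leq_sum => i _; rewrite /pot leq_subr.
  by rewrite sum_nat_const cardC1 card_ord.
have tK := toll_homo (leq_subr r K).
have potv : pot v v' = (toll K - toll (K - r))%N by [].
have tp : (p * toll K = p.-1 * toll K + toll K)%N by rewrite -mulSnr prednK.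
rewrite potv mulnBr; have := leq_mul (leqnn p) tK.
move: potj others; rewrite mulnS.
set X := (\sum_(i < p | i != j) _)%N. lia.
Qed.

(** The mean potential [Phi m] of level [m] loses at least the proportion of mismatched nodes of
    that level when passing to the next one. It is nonnegative and starts at most at [toll K], so
    the losses sum to at most [toll K]. *)
Lemma matching : exists pi, forall n,
  \sum_(m < n) \sum_(v : m.-tuple 'I_p)
    p%:R^-1 ^+ m * (tau v != tau' (twist pi v))%:R <= (toll K)%:R :> R.
Proof.
have [pi0 pi0P] : exists pi0 : seq 'I_p * seq 'I_p -> 'S_p, forall v v',
    if tau v == tau' v' then forall j, tau (j :: v) = tau' (pi0 (v, v') j :: v')
    else exists j, (dist (j :: v) (pi0 (v, v') j :: v') < dist v v')%N.
  have /choice[f fP] : forall vv : seq 'I_p * seq 'I_p, exists pi : 'S_p,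
    if tau vv.1 == tau' vv.2 then
      forall j, tau (j :: vv.1) = tau' (pi j :: vv.2)
    else exists j, (dist (j :: vv.1) (pi j :: vv.2) < dist vv.1 vv.2)%N.
    by move=> [v v']; exact: step.
  by exists f => v v'; exact: (fP (v, v')).
exists (fun v v' => pi0 (v, v')) => n; set B := twist _.
pose Phi m : R := p%:R^-1 ^+ m * (\sum_(v : m.-tuple 'I_p) pot v (B v))%:R.
have p0 : (p%:R : R) != 0 by rewrite pnatr_eq0 -lt0n.
(* Keeping the remaining potential [Phi n] on the left makes the bound inductive. *)
suff H : \sum_(m < n) \sum_(v : m.-tuple 'I_p)
    p%:R^-1 ^+ m * (tau v != tau' (B v))%:R + Phi n <= (toll K)%:R :> R.
  by apply: le_trans H; rewrite lerDl /Phi mulr_ge0 // exprn_ge0 // invr_ge0.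
elim: n => [|n IH].
  rewrite big_ord0 add0r /Phi expr0 mul1r ler_nat.
  rewrite (bigD1 [tuple]) //= big1 => [|v]; last by rewrite (tuple0 v) => /eqP.
  by rewrite addn0 /pot leq_subr.
rewrite big_ord_recr /= -addrA; apply: le_trans IH; rewrite lerD2l.
rewrite -mulr_sumr /Phi exprSr -!mulrA -mulrDr.
rewrite ler_wpM2l ?exprn_ge0 ?invr_ge0 ?ler0n //.
rewrite -(ler_pM2l (x := p%:R)) ?ltr0n // mulrDr mulVKf //.
rewrite -natr_sum -!natrM -natrD ler_nat.
rewrite (sum_tuple_cons (fun v => pot v (B v))) !big_distrr -big_split /=.
apply: leq_sum => v _; rewrite addnC.
apply: (sum_pot (pi := fun j => pi0 (v : seq _, B v) j)); exact: pi0P.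
Qed.

End Matching.

(** * Approximation of measurable sets by finitely many coordinates *)

Section PastSequences.
Variable N : nat.
Local Notation X := (past_seq N).
Implicit Types x y z : X.

Definition agree n x y := forall i, (i < n)%N -> x i = y i.

Definition cyl n x : set (borel X) := [set y | agree n x y].

Lemma agree_sym n x y : agree n x y -> agree n y x.
Proof. by move=> xy i /xy. Qed.

Lemma agreeW m n x y : (m <= n)%N -> agree n x y -> agree m x y.
Proof. by move=> mn xy i im; apply: xy; exact: leq_trans mn. Qed.

Lemma cyl_open n x : open (cyl n x : set X).
Proof.
elim: n => [|n IH].
  rewrite (_ : cyl 0 x = setT); first exact: openT.
  by apply/seteqP; split.
rewrite (_ : cyl n.+1 x =
    cyl n x `&` (@proj nat (fun=> discrete_topology 'I_N.+1) n @^-1` [set x n])).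
  apply: openI => //; apply: open_comp; last exact: discrete_open.
  move=> z _.
  exact: (@proj_continuous nat (fun=> discrete_topology 'I_N.+1) n z).
apply/seteqP; split=> y /=.
  by move=> xy; split; [exact: agreeW xy|rewrite /proj xy].
move=> [xy yn] i; rewrite ltnS leq_eqVlt => /predU1P[->|/xy//].
by rewrite -yn.
Qed.

(** Otherwise points outside [U] agreeing with [x] on ever more coordinates would converge to [x],
    convergence being coordinatewise. *)
Lemma nbhs_cyl (U : set X) x : nbhs x U -> exists n, cyl n x `<=` U.
Proof.
move=> xU; apply: contrapT => /forallNP nU.
have /choice[f fP] n : exists y, cyl n x y /\ ~ U y.
  by move: (nU n) => /existsNP[y /not_implyP ?]; exists y.
suff fx : (f : nat -> X) @ \oo --> x.
  have [n _ /(_ n (leqnn n))] := fx _ xU.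
  by have [] := fP n.
apply/cvg_sup => k V [W] [[Y oY <-] WxY WV].
exists k.+1 => // i /= ki; apply: WV => /=.
by have [/(_ k ki) <-] := fP i.
Qed.

(** Such a set contains the open cylinder of length [n] around each of its points, hence is open. *)
Lemma measurable_agree n (B : set (borel X)) :
  (forall x y, agree n x y -> B x -> B y) -> measurable B.
Proof.
move=> nB; apply: sub_sigma_algebra; rewrite openE => x Bx.
rewrite /interior; apply: (@filterS _ _ _ (cyl n x)).
  by move=> y xy; exact: nB Bx.
by apply: open_nbhs_nbhs; split; [exact: cyl_open|].
Qed.

Lemma open_bigcup_cyl (U : set X) : open U ->
  U = \bigcup_n [set x | cyl n x `<=` U].
Proof.
rewrite openE => oU; apply/seteqP; split=> [x /oU /nbhs_cyl[n nU]|x [n _]].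
  by exists n.
by apply.
Qed.

Lemma cyl_subset_agree n (U : set X) x y :
  agree n x y -> cyl n x `<=` U -> cyl n y `<=` U.
Proof. by move=> xy nU z yz; apply: nU => i ni; rewrite xy // yz. Qed.

Variables (R : realType) (mu : probability (borel X) R).

(** Approximability of [B] by sets of finitely many coordinates. An exceptional set, rather than a
    symmetric difference, lets it be applied pointwise at the nodes of a tree. Exchanging [x] and
    [y] turns the implication into an equivalence. *)
Definition almost_local (B : set (borel X)) := forall eta : R, 0 < eta ->
  exists l (E : set (borel X)), [/\ measurable E, (mu E <= eta%:E)%E &
    forall x y, ~ E x -> ~ E y -> agree l x y -> B x -> B y].

Lemma almost_localU (B C : set (borel X)) :
  almost_local B -> almost_local C -> almost_local (B `|` C).
Proof.
move=> lB lC eta eta0; have e20 : 0 < eta / 2 by rewrite divr_gt0.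
have [k [E [mE Ee EB]]] := lB _ e20; have [l [F [mF Fe FC]]] := lC _ e20.
exists (maxn k l), (E `|` F); split; first exact: measurableU.
  rewrite (splitr eta) EFinD; apply: le_trans (leeD Ee Fe).
  exact: measureU2.
move=> x y /not_orP[nEx nFx] /not_orP[nEy nFy] xy [Bx|Cx].
  by left; apply: (EB x) => //; apply: agreeW xy; rewrite leq_maxl.
by right; apply: (FC x) => //; apply: agreeW xy; rewrite leq_maxr.
Qed.

Lemma almost_local_open (U : set X) n :
  almost_local ([set x | cyl n x `<=` U] : set (borel X)).
Proof.
move=> eta eta0; exists n, set0; split => //; first by rewrite measure0 lee_fin ltW.
by move=> x y _ _; exact: cyl_subset_agree.
Qed.

(** A finite partial union is almost local, and what is left of the whole union decreases to the
    empty set. A remainder of measure at most [eta / 2] is put into the exceptional set. *)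
Lemma almost_local_bigcup (F : (set (borel X))^nat) :
  (forall n, measurable (F n)) -> (forall n, almost_local (F n)) ->
  almost_local (\bigcup_n F n).
Proof.
move=> mF lF eta eta0; have e20 : 0 < eta / 2 by rewrite divr_gt0.
pose V n := \big[setU/set0]_(i < n) F i.
have mV n : measurable (V n) by exact: bigsetU_measurable.
have mU : measurable (\bigcup_n F n) by exact: bigcup_measurable.
have lV n : almost_local (V n).
  elim: n => [|n IH]; rewrite /V; last by rewrite big_ord_recr; exact: almost_localU.
  rewrite big_ord0 => e e0; exists 0%N, set0; split=> //.
  by rewrite measure0 lee_fin ltW.
have [n Vn] : exists n, (mu ((\bigcup_n F n) `\` V n) <= (eta / 2)%:E)%E.
  pose D n := (\bigcup_n F n) `\` V n.
  have mD i : measurable (D i) by exact: measurableD.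
  have D0 : \bigcap_n D n = set0.
    apply/seteqP; split=> // x Dx; have [[k _ Fk] _] := Dx 0%N I.
    have [_] := Dx k.+1 I; apply; rewrite /V -bigcup_mkord.
    by exists k => /=.
  have : mu \o D @ \oo --> mu (\bigcap_n D n).
    apply: nonincreasing_cvg_mu => //.
    - exact: le_lt_trans (probability_le1 mu (mD 0%N)) (ltry _).
    - by rewrite D0.
    - move=> i j ij; apply/subsetPset; apply: setDS.
      rewrite /V -!bigcup_mkord => x [k /= ki Fk].
      by exists k => //=; exact: leq_trans ij.
  rewrite D0 measure0 => /fine_cvgP[_] /cvgrPdist_le /(_ _ e20)[n _].
  move=> /(_ n (leqnn n)).
  rewrite /= sub0r normrN ger0_norm ?fine_ge0 ?measure_ge0 // => Dn.
  exists n; rewrite -(@fineK _ (mu (D n))) ?lee_fin //.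
  by apply: fin_num_measure.
have [l [E [mE Ee EV]]] := lV n _ e20.
exists l, (E `|` ((\bigcup_n F n) `\` V n)); split.
- by apply: measurableU => //; exact: measurableD.
- rewrite (splitr eta) EFinD; apply: le_trans (leeD Ee Vn).
  by apply: measureU2 => //; exact: measurableD.
move=> x y /not_orP[nEx nDx] /not_orP[nEy nDy] xy Ux.
have : V n x by apply: contrapT => nVx; apply: nDx.
move=> /(EV x y nEx nEy xy); rewrite /V -bigcup_mkord => -[k _ Fk].
by exists k.
Qed.

(** The measurable almost local sets form a sigma-algebra containing the open sets. Measurability is
    carried along because the step for countable unions uses it. *)
Lemma measurable_almost_local (B : set (borel X)) : measurable B -> almost_local B.
Proof.
move=> mB; suff [] : measurable B /\ almost_local B by [].
move: B mB; apply: smallest_sub; last first.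
  move=> U oU; split; first exact: sub_sigma_algebra.
  rewrite (open_bigcup_cyl oU); apply: almost_local_bigcup => n.
    by apply: (@measurable_agree n) => x y; exact: cyl_subset_agree.
  exact: almost_local_open.
split.
- split=> // e e0; exists 0%N, set0; split=> //.
  by rewrite measure0 lee_fin ltW.
- move=> A [mA lA]; split; first by rewrite setTD; exact: measurableC.
  move=> e /lA[l [E [mE Ee EA]]]; exists l, E; split=> // x y nEx nEy xy.
  move=> [_ nAx]; split=> // Ay; apply: nAx; apply: EA Ay => //.
  exact: agree_sym.
- move=> F FP; split; first by apply: bigcup_measurable => n _; have [] := FP n.
  by apply: almost_local_bigcup => n; have [] := FP n.
Qed.

Lemma seq_almost_local (s : seq (set (borel X))) (eta : R) : 0 < eta ->
  (forall B, B \in s -> measurable B) ->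
  exists l (E : set (borel X)), [/\ measurable E, (mu E <= eta%:E)%E &
    forall x y, ~ E x -> ~ E y -> agree l x y -> forall B, B \in s -> B x -> B y].
Proof.
elim: s eta => [|B s IH] eta eta0 ms.
  exists 0%N, set0; split=> //; first by rewrite measure0 lee_fin ltW.
have e20 : 0 < eta / 2 by rewrite divr_gt0.
have mB : measurable B by apply: ms; rewrite inE eqxx.
have [k [E [mE Ee EB]]] := measurable_almost_local mB e20.
have [|l [F [mF Fe FC]]] := IH _ e20.
  by move=> C Cs; apply: ms; rewrite inE Cs orbT.
exists (maxn k l), (E `|` F); split; first exact: measurableU.
  rewrite (splitr eta) EFinD; apply: le_trans (leeD Ee Fe).
  exact: measureU2.
move=> x y /not_orP[nEx nFx] /not_orP[nEy nFy] xy C.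
rewrite inE => /predU1P[->|Cs].
  by apply: EB => //; apply: agreeW xy; rewrite leq_maxl.
by apply: (FC x y) => //; apply: agreeW xy; rewrite leq_maxr.
Qed.

(** * Functions into a compact metric space *)

Variable M : metricType R.

Lemma compact_ball_cover (a : M) (e : R) : 0 < e -> compact [set: M] ->
  exists s : seq M, forall z : M, exists2 c, c \in s & (ball c e)^° z.
Proof.
move=> e0 cM.
(* The covering form of compactness is applied to [M] with base point [a]. *)
pose M' : ptopologicalType := HB.pack M (isPointed.Build M a).
move: (cM : compact [set: M']).
rewrite compact_cover => /(_ M setT (fun c => (ball c e)^°)).
case=> [c _|z _|D _ DP].
- exact: open_interior.
- by exists z => //; exact: nbhsx_ballx.
- exists (enum_fset D) => z; have [c /= cD cz] := DP z I.
  by exists c.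
Qed.

Lemma mdist_bounded (a : M) : compact [set: M] ->
  exists2 D : R, 0 < D & forall b c : M, mdist b c <= D.
Proof.
move=> /(compact_ball_cover a ltr01)[s sP].
(* The sum of all distances between centres bounds each of them; the 2 added below accounts for the
   radii of two unit balls. *)
pose D := \sum_(c <- s) \sum_(d <- s) mdist c d.
have D0 : 0 <= D.
  by apply: sumr_ge0 => c _; apply: sumr_ge0 => d _; exact: mdist_ge0.
exists (D + 2) => [|{}a b]; first by rewrite ltr_wpDl.
have [c cs /interior_subset] := sP a; have [d ds /interior_subset] := sP b.
rewrite !ballEmdist /= => db ca.
have cd : mdist c d <= D.
  rewrite /D (big_rem c) //= (big_rem d) //= -addrA lerDl addr_ge0 //.
    by apply: sumr_ge0 => ? _; exact: mdist_ge0.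
  by apply: sumr_ge0 => ? _; apply: sumr_ge0 => ? _; exact: mdist_ge0.
have := metric_triangle a c b; have := metric_triangle c d b.
rewrite metric_sym in ca; lra.
Qed.

(** Finitely many balls of radius [e / 2] cover [M]. Off [E], agreement on [l] coordinates puts
    [g y] into a ball of the cover that contains [g x]. *)
Lemma almost_uniformly_local (g : borel X -> M) (e eta : R) :
  0 < e -> 0 < eta -> compact [set: M] ->
  (forall U : set M, open U -> measurable (g @^-1` U)) ->
  exists l (E : set (borel X)), [/\ measurable E, (mu E <= eta%:E)%E &
    forall x y, ~ E x -> ~ E y -> agree l x y -> mdist (g x) (g y) < e].
Proof.
move=> e0 eta0 cM mg; have e20 : 0 < e / 2 by rewrite divr_gt0.
have [s sP] := compact_ball_cover (g point) e20 cM.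
have [|l [E [mE Ee EP]]] :=
    @seq_almost_local [seq g @^-1` (ball c (e / 2))^° | c <- s] eta eta0.
  by move=> B /mapP[c _ ->]; apply: mg; exact: open_interior.
exists l, E; split=> // x y nEx nEy xy; have [c cs gx] := sP (g x).
have /interior_subset := EP x y nEx nEy xy _ (map_f _ cs) gx.
have := interior_subset gx; rewrite !ballEmdist /= => cx cy.
have := metric_triangle (g x) c (g y); rewrite (metric_sym (g x) c); lra.
Qed.

End PastSequences.

(** * Fibre kernels, inverse branches and visits of the tree to a small set *)

Lemma uniform_atoms_measure d (X : measurableType d) (R : realType)
    (nu : {measure set X -> \bar R}) (p : nat) (e : 'I_p -> X) (B : set X) :
  (forall x : X, measurable [set x]) -> (0 < p)%N -> injective e ->
  nu setT = 1%E -> (forall j, nu [set e j] = (p%:R^-1)%:E) -> measurable B ->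
  nu B = (\sum_(j < p) p%:R^-1 * \1_B (e j))%:E.
Proof.
move=> m1 p0 einj nu1 nue mB.
have sumU A : measurable A ->
    nu (A `&` \big[setU/set0]_(j < p) [set e j]) =
    (\sum_(j < p) p%:R^-1 * \1_A (e j))%:E.
  move=> mA; rewrite big_distrr /= measure_bigsetU_ord; last 2 first.
  - by move=> j; exact: measurableI.
  - by move=> i j _ _ [x [[_ ->] [_ /einj]]].
  rewrite -sumEFin; apply: eq_bigr => j _; rewrite indicE.
  have [ejA|ejA] := boolP (e j \in A).
    rewrite mulr1 (_ : A `&` _ = [set e j]); first exact: nue.
    by apply: setIidr => _ ->; apply: set_mem.
  rewrite mulr0 (_ : A `&` _ = set0) ?measure0 //.
  apply/seteqP; split=> // x [Ax xe]; move: ejA; rewrite -xe => /negP; apply.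
  exact: mem_set.
set F := \big[setU/set0]_(j < p) [set e j] in sumU.
have mF : measurable F by exact: bigsetU_measurable.
have DI A : measurable A -> nu A = (nu (A `\` F) + nu (A `&` F))%E.
  by move=> mA; exact: measureDI.
(* The [p] atoms of mass [1/p] exhaust the total mass 1, so their complement is null. *)
have F0 : nu (~` F) = 0%E.
  have := DI _ measurableT; rewrite sumU // indicT setTD nu1 /=.
  under eq_bigr do rewrite mulr1.
  rewrite sumr_const card_ord -[_ *+ p]mulr_natr mulVf ?pnatr_eq0 -?lt0n //.
  have : (0 <= nu (~` F))%E by exact: measure_ge0.
  case: (nu _) => // r _ [] r1; congr (_%:E); lra.
rewrite -sumU // (DI _ mB) -[RHS]add0e; congr (_ + _)%E.
apply: subset_measure0 F0; [exact: measurableD|exact: measurableC|].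
by move=> x [].
Qed.

Section Branches.
Context d (X : measurableType d) (R : realType) (mu : probability X R).
Variables (T : X -> X) (p : nat).
Hypotheses (measurable1 : forall x : X, measurable [set x]) (p_gt0 : (0 < p)%N).
Local Notation unif := (fun _ : 'I_p => p%:R^-1 : R).
Variables (X0 : set X) (k : R.-pker X ~> X).
Hypothesis k_fibre : fibre_probability mu T k.

Lemma fibre_listing_kernel x e (B : set X) : fibre_listing T unif X0 k x e ->
  measurable B -> k x B = (\sum_(j < p) p%:R^-1 * \1_B (e j))%:E.
Proof.
move=> [einj _ ke] mB; apply: uniform_atoms_measure => //.
exact: prob_kernel.
Qed.

Variables (K : X -> 'I_p) (br : 'I_p -> X -> X).
Hypothesis mK : measurable_label K.
Hypothesis br_listing : {ae mu, forall x,
  fibre_listing T unif X0 k x (br^~ x) /\ forall j, K (br j x) = j}.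

(* Measurable and almost everywhere equal to the preimage of [E] under [br j],
  which itself need not be measurable. *)
Definition pull j (E : set X) : set X :=
  [set x | k x (E `&` K @^-1` [set j]) != 0%E].

Lemma measurable_pull j E : measurable E -> measurable (pull j E).
Proof.
move=> mE; rewrite (_ : pull j E =
   ~` ((k ^~ (E `&` K @^-1` [set j])) @^-1` [set 0%E])); last first.
  by apply/seteqP; split=> x /eqP.
apply: measurableC; rewrite -[X in measurable X]setTI.
by apply: measurable_kernel => //; apply: measurableI => //; exact: mK.
Qed.

(** Among the [p] listed preimages of [x], only [br j x] has label [j]. *)
Lemma pull_kernel j E : measurable E ->
  \forall x \ae mu, k x (E `&` K @^-1` [set j]) = (p%:R^-1 * \1_E (br j x))%:E.
Proof.
move=> mE; apply: filterS br_listing => x [lx Kx].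
rewrite (fibre_listing_kernel lx); last by apply: measurableI => //; exact: mK.
have Kj i : \1_(K @^-1` [set j]) (br i x) = (i == j)%:R :> R.
  rewrite indicE; congr (nat_of_bool _)%:R.
  by apply/idP/eqP => [/set_mem|ij]; [|apply/mem_set]; rewrite /= Kx.
congr (_%:E); rewrite (bigD1 j) //= big1 ?addr0 => [|i ij].
  by rewrite indicI /= Kj eqxx mulr1.
by rewrite indicI /= Kj (negPf ij) !mulr0.
Qed.

Lemma pullP j E : measurable E ->
  \forall x \ae mu, pull j E x <-> E (br j x).
Proof.
move=> mE; apply: filterS (pull_kernel j mE) => x; rewrite /pull /= => ->.
have p0 : (p%:R^-1 : R) != 0 by rewrite invr_eq0 pnatr_eq0 -lt0n.
rewrite eqe mulf_eq0 (negPf p0) /= indicE pnatr_eq0 eqb0 negbK.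
by split; [exact: set_mem|exact: mem_set].
Qed.

(** Almost everywhere the kernel of the part of [E] labelled [j] is [1/p] times the indicator of
    [pull j E]; integrating gives the factor [p]. *)
Lemma measure_pull j E : measurable E ->
  mu (pull j E) = (p%:R%:E * mu (E `&` K @^-1` [set j]))%E.
Proof.
move=> mE; have mEj : measurable (E `&` K @^-1` [set j]).
  by apply: measurableI => //; exact: mK.
have p0 : (p%:R : R) != 0 by rewrite pnatr_eq0 -lt0n.
have -> : mu (E `&` K @^-1` [set j]) = (p%:R^-1%:E * mu (pull j E))%E.
  have := k_fibre mEj measurableT; rewrite preimage_setT setIT => ->.
  have mp := measurable_pull j mE.
  rewrite -[pull j E]setIT -integral_indic // -ge0_integralZl_EFin //; last first.
    by apply/measurable_EFinP; exact: measurable_indic.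
  apply: ge0_ae_eq_integral => //.
  - exact: measurable_kernel.
  - apply: emeasurable_funM => //.
    by apply/measurable_EFinP; exact: measurable_indic.
  - apply: (filterS2 _ _ (pull_kernel j mE) (pullP j mE)) => x kx px _.
    rewrite kx EFinM; congr (_ * _%:E)%E; rewrite !indicE; congr (_%:R).
    by congr (nat_of_bool _); apply/idP/idP => /set_mem /px /mem_set.
by rewrite muleA -EFinM mulfV // mul1e.
Qed.

(** By [measure_pull] the pullback of a null set along a branch is null. Induction on the length of
    the node, one symbol at a time from the root, then covers the countably many nodes. *)
Lemma ae_branch (P : X -> Prop) : {ae mu, forall x, P x} ->
  {ae mu, forall x, forall v, P (foldr br x v)}.
Proof.
move=> aeP; have aeB (Q : X -> Prop) j : {ae mu, forall x, Q x} ->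
    {ae mu, forall x, Q (br j x)}.
  move=> [E [mE E0 QE]]; have pE := pullP j mE.
  have : {ae mu, forall x, ~ pull j E x}.
    exists (pull j E); split=> [||x /contrapT//]; first exact: measurable_pull.
    rewrite measure_pull // [X in (_ * X)%E](_ : _ = 0%E) ?mule0 //.
    by apply: subset_measure0 E0 => //; apply: measurableI => //; exact: mK.
  apply: (filterS2 _ _ pE) => x pEx npx; apply: contrapT => nQ; apply: npx.
  by apply/pEx; exact: QE.
suff aen : {ae mu, forall x, forall n, forall v, size v = n -> P (foldr br x v)}.
  by apply: filterS aen => x Px v; exact: Px.
apply: ae_foralln; elim=> [|n IH].
  by apply: filterS aeP => x Px v /size0nil ->.
have : {ae mu, forall x, forall j, forall v,
    size v = n -> P (foldr br (br j x) v)}.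
  apply: filter_forall => j.
  exact: (aeB (fun y => forall v, size v = n -> P (foldr br y v)) j IH).
apply: filterS => x Px v; case/lastP: v => // v j.
by rewrite size_rcons foldr_rcons => -[]; exact: Px.
Qed.

(** A measurable version of the set of [x] whose node [v] lies in [E]. The branch of the leftmost
    symbol is applied last, so it is pulled back first; hence [foldl]. *)
Definition visit (E : set X) (v : seq 'I_p) : set X :=
  foldl (fun F j => pull j F) E v.

Lemma measurable_visit E v : measurable E -> measurable (visit E v).
Proof. by elim: v E => //= j v IH E mE; apply: IH; exact: measurable_pull. Qed.

Lemma visitP E : measurable E ->
  {ae mu, forall x, forall v, visit E v x <-> E (foldr br x v)}.
Proof.
move=> mE.
suff aen : {ae mu, forall x, forall n, forall v, size v = n ->
    (visit E v x <-> E (foldr br x v))}.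
  by apply: filterS aen => x Px v; exact: Px.
apply: ae_foralln => n; elim: n E mE => [|n IH] E mE.
  by apply: nearW => x v /size0nil ->.
have : {ae mu, forall x, forall j, (forall v, size v = n ->
    (visit (pull j E) v x <-> pull j E (foldr br x v))) /\
    (forall v, pull j E (foldr br x v) <-> E (br j (foldr br x v)))}.
  apply: filter_forall => j.
  apply: (filterS2 _ _ (IH _ (measurable_pull j mE)) (ae_branch (pullP j mE))).
  by move=> x H1 H2; split.
apply: filterS => x Px [//|j v] /= [] vn; have [H1 H2] := Px j.
by apply: iff_trans (H2 v); exact: H1.
Qed.

(** Each level multiplies the total by [p], since the label cells partition the space. Hence the
    mean proportion of nodes of level [m] lying in [E] is the measure of [E]. *)
Lemma sum_measure_visit E m : measurable E ->
  \sum_(v : m.-tuple 'I_p) fine (mu (visit E v)) = p%:R ^+ m * fine (mu E).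
Proof.
elim: m E => [|m IH] E mE.
  rewrite (bigD1 [tuple]) //= big1 ?addr0 ?mul1r // => v.
  by rewrite (tuple0 v) => /eqP.
rewrite (sum_tuple_cons (fun v => fine (mu (visit E v)))) exchange_big /=.
have mEK j : measurable (E `&` K @^-1` [set j]).
  by apply: measurableI => //; exact: mK.
have -> : fine (mu E) = \sum_(j < p) fine (mu (E `&` K @^-1` [set j])).
  rewrite sum_fine => [|j _]; last exact: fin_num_measure.
  rewrite -measure_bigsetU_ord => [|//|]; last first.
    by move=> i j _ _ [x [[_ /= <-] [_ /= <-]]].
  rewrite -big_distrr /= (_ : \big[setU/set0]_(j < p) _ = setT) ?setIT //.
  apply/seteqP; split=> // x _; rewrite -bigcup_seq.
  by exists (K x) => //=; rewrite mem_index_enum.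
rewrite exprSr -mulrA !mulr_sumr; apply: eq_bigr => j _.
rewrite [LHS](IH _ (measurable_pull j mE)) measure_pull //.
by rewrite fineM ?fin_num_measure.
Qed.

(** The weighted number [f] of visits in the levels 1 to [n] has integral [n] times the measure of
    [E]; Markov's inequality at the threshold [n * delta] bounds the bad set. *)
Lemma rarely_visiting (P : X -> Prop) (E : set X) n (delta : R) :
  {ae mu, forall x, P x} -> measurable E -> (0 < n)%N -> 0 < delta ->
  exists G : set X,
    [/\ measurable G, ((1 - fine (mu E) / delta)%:E <= mu G)%E &
      forall x, G x -> P x /\ \sum_(1 <= m < n.+1) \sum_(v : m.-tuple 'I_p)
        p%:R^-1 ^+ m * \1_E (foldr br x v) <= n%:R * delta].
Proof.
move=> aeP mE n0 delta0.
pose f x : R := \sum_(1 <= m < n.+1) \sum_(v : m.-tuple 'I_p)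
  p%:R^-1 ^+ m * \1_(visit E v) x.
have p0 : (p%:R : R) != 0 by rewrite pnatr_eq0 -lt0n.
have w0 m : 0 <= p%:R^-1 ^+ m :> R by rewrite exprn_ge0 // invr_ge0.
have g0 m x (v : seq 'I_p) : 0 <= p%:R^-1 ^+ m * \1_(visit E v) x :> R.
  by rewrite mulr_ge0.
have mg m (v : seq 'I_p) :
    measurable_fun setT (fun x => p%:R^-1 ^+ m * \1_(visit E v) x : R).
  apply: measurable_funM => //; apply: measurable_indic.
  exact: measurable_visit.
have mh m : measurable_fun setT (fun x => \sum_(v : m.-tuple 'I_p)
    p%:R^-1 ^+ m * \1_(visit E v) x : R).
  by apply: measurable_sum => v.
have mf : measurable_fun setT f by apply: measurable_sum => m.
have f0 x : 0 <= f x by apply: sumr_ge0 => m _; apply: sumr_ge0.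
have intf : (\int[mu]_x (f x)%:E = (n%:R * fine (mu E))%:E)%E.
  under eq_integral => x _ do rewrite /f -sumEFin.
  rewrite ge0_integral_sum //; last 2 first.
  - by move=> m; apply/measurable_EFinP.
  - by move=> m x _; rewrite lee_fin; apply: sumr_ge0.
  rewrite (_ : n%:R * _ = \sum_(1 <= m < n.+1) fine (mu E)); last first.
    by rewrite sumr_const_nat subn1 mulr_natl.
  rewrite -sumEFin; apply: eq_bigr => m _.
  under eq_integral => x _ do rewrite -sumEFin.
  rewrite ge0_integral_sum //; last first.
    by move=> v; apply/measurable_EFinP.
  have -> : fine (mu E) = \sum_(v : m.-tuple 'I_p)
      p%:R^-1 ^+ m * fine (mu (visit E v)).
    by rewrite -mulr_sumr sum_measure_visit // mulrA -exprMn mulVf // expr1n mul1r.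
  rewrite -sumEFin; apply: eq_bigr => v _.
  under eq_integral => x _ do rewrite EFinM.
  rewrite ge0_integralZl_EFin //; last first.
    by apply/measurable_EFinP/measurable_indic/measurable_visit.
  rewrite integral_indic ?setIT //; last exact: measurable_visit.
  by rewrite EFinM fineK // fin_num_measure //; exact: measurable_visit.
pose t : R := n%:R * delta; have t0 : 0 < t by rewrite mulr_gt0 // ltr0n.
pose S := [set x | t <= f x].
have mS : measurable S.
  rewrite (_ : S = setT `&` f @^-1` `[t, +oo[); first exact: mf.
  by rewrite setTI; apply/seteqP; split=> x; rewrite /= in_itv /= andbT.
have muS : (mu S <= (fine (mu E) / delta)%:E)%E.
  have := @le_integral_comp_abse _ _ _ mu setT measurableT (EFin \o f) t id
    (@measurable_id _ _ _) (fun _ => id) (fun _ _ _ _ => id).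
  move=> /(_ _ t0); rewrite setTI.
  under eq_integral => x _ do rewrite /= ger0_norm //.
  rewrite intf (_ : [set x | _] = S); last first.
    by apply/seteqP; split=> x /=; rewrite lee_fin ger0_norm.
  move=> /(_ ((measurable_EFinP _ _).2 mf)).
  have fS : mu S \is a fin_num by exact: fin_num_measure.
  rewrite -(fineK fS) => tS; have : (t%:E * (fine (mu S))%:E <=
      (n%:R * fine (mu E))%:E)%E by rewrite fineK.
  rewrite -EFinM !lee_fin -ler_pdivlMl // => /le_trans; apply.
  by rewrite /t invfM mulrACA mulVf ?pnatr_eq0 -?lt0n // mul1r mulrC.
(* Removing this null set as well makes the conclusion hold at every point of [G], with true nodes
   in place of the sets [visit E v]. *)
have [Z [mZ Z0 PZ]] : mu.-negligible (~` [set x | P x /\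
    forall v, visit E v x <-> E (foldr br x v)]).
  exact: (filterI aeP (visitP mE)).
exists (~` (S `|` Z)); split.
- by apply: measurableC; exact: measurableU.
- rewrite probability_setC; last exact: measurableU.
  by rewrite measureU0 // EFinB leeB.
move=> x /= /not_orP[Sx Zx].
have [Px Ex] : P x /\ forall v, visit E v x <-> E (foldr br x v).
  by apply: contrapT => nx; apply: Zx; apply: PZ.
split=> //; apply/ltW; move/negP: Sx; rewrite -ltNge; apply: le_lt_trans.
apply: ler_sum => m _; apply: ler_sum => v _; rewrite ler_wpM2l // !indicE.
by rewrite ler_nat; case: (boolP (_ \in E)) => // /set_mem /Ex /mem_set ->.
Qed.

End Branches.

(** * Transition probabilities and mixing of the Markov shift *)

Section MarkovChain.
Variables (N : nat) (R : realType) (A : 'M[R]_N.+1).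
Local Notation X := (past_seq N).
Local Notation T := (@past_shift N).
Variables (mu : probability (borel X) R) (q : 'rV[R]_N.+1).
Hypotheses (A_stoch : stochastic A) (q_stat : stationary_vector A q).
Hypothesis mT : measurable_fun setT T.
Hypothesis T_inv : forall B : set (borel X),
  measurable B -> mu (T @^-1` B) = mu B.
Hypothesis mu_cyl : forall (n : nat) (a : nat -> 'I_N.+1),
  mu [set x | forall i, (i <= n)%N -> x i = a i] =
  (q ord0 (a n) * \prod_(i < n) A (a i.+1) (a i))%:E.

Definition prepend b (x : X) : X := fun n => if n is m.+1 then x m else b.

Definition head_set b : set (borel X) := [set x | x 0%N = b].

Lemma measurable_head b : measurable (head_set b).
Proof.
by apply: (@measurable_agree _ 1) => x y xy; rewrite /head_set /= xy.
Qed.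

Lemma measurable_cyl n (x : X) : measurable (cyl n x).
Proof. by apply: (@measurable_agree _ n) => y z yz xy i ni; rewrite xy ?yz. Qed.

Lemma measurable_point (x : borel X) : measurable [set x].
Proof.
rewrite (_ : [set x] = \bigcap_n cyl n x).
  by apply: bigcapT_measurable => n; exact: measurable_cyl.
apply/seteqP; split=> [y -> n _ //|y xy].
by apply/funext => i; rewrite (xy i.+1).
Qed.

Lemma measure_cyl n (x : X) : mu (cyl n.+1 x) =
  (q ord0 (x n) * \prod_(i < n) A (x i.+1) (x i))%:E.
Proof.
rewrite -mu_cyl; congr (mu _); apply/seteqP.
by split=> y xy i ni; rewrite xy.
Qed.

Lemma measure_head a : mu (head_set a) = (q ord0 a)%:E.
Proof.
have := measure_cyl 0 ((fun=> a) : X); rewrite big_ord0 mulr1 => <-.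
congr (mu _); apply/seteqP; split=> x; last by move=> /(_ 0%N isT).
by move=> /= <- [].
Qed.

Definition cylinders : set (set (borel X)) :=
  [set B | B = set0 \/ exists n x, B = cyl n x].

Lemma setI_closed_cylinders : setI_closed cylinders.
Proof.
move=> B C [->|[m [x ->]]]; first by left; rewrite set0I.
move=> [->|[n [y ->]]]; first by left; rewrite setI0.
(* Two cylinders are either nested or disjoint. *)
have cylI (k l : nat) (u v : X) : (k <= l)%N -> cylinders (cyl k u `&` cyl l v).
  move=> kl; have [uv|nuv] := pselect (agree k u v).
    right; exists l, v; apply/seteqP; split=> [z [_ //]|z vz]; split=> //.
    by move=> i ik; rewrite uv // vz // (leq_trans ik).
  left; apply/seteqP; split=> // z [uz vz]; apply: nuv => i ik.
  by rewrite uz // vz // (leq_trans ik).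
by have [mn|/ltnW nm] := leqP m n; [|rewrite setIC]; exact: cylI.
Qed.

Lemma sigma_cylinders : @measurable _ (borel X) = <<s cylinders >>.
Proof.
apply/seteqP; split; apply: smallest_sub; try exact: smallest_sigma_algebra.
(* An open set is a union of cylinders over finite words, enumerated by [unpickle]. The default
   [ord0] of [nth] only fills coordinates beyond the word, which the cylinder ignores. *)
- move=> U oU; pose C (w : seq 'I_N.+1) : set X := cyl (size w) (nth ord0 w : X).
  pose F k : set (borel X) := if choice.unpickle k is Some w then
    if `[< C w `<=` U >] then C w else set0 else set0.
  have -> : U = \bigcup_k F k.
    apply/seteqP; split=> [x|x [k _]]; last first.
      by rewrite /F; case: choice.unpickle => // w; case: asboolP => // wU; exact: wU.
    rewrite {1}(open_bigcup_cyl oU) => -[n _ nU].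
    have xC : agree n x (nth ord0 (mkseq x n) : X).
      by move=> i ni; rewrite nth_mkseq.
    exists (choice.pickle (mkseq x n)) => //; rewrite /F choice.pickleK /C size_mkseq.
    case: asboolP => [_ i ni|]; first by rewrite xC.
    by case=> y /= wy; apply: nU => i ni; rewrite xC // wy.
  apply: sigma_algebra_bigcup => k; apply: sub_sigma_algebra; rewrite /F.
  case: choice.unpickle => [w|]; last by left.
  by case: asboolP => _; [right; exists (size w), (nth ord0 w : X)|left].
- by move=> B [->|[n [x ->]]]; [exact: measurable0|exact: measurable_cyl].
Qed.

Lemma measure_transition_cyl a b m (x : X) : x 0%N = a ->
  mu (head_set b `&` T @^-1` cyl m.+1 x) = ((A a b)%:E * mu (cyl m.+1 x))%E.
Proof.
move=> x0; have -> : head_set b `&` T @^-1` cyl m.+1 x = cyl m.+2 (prepend b x).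
  apply/seteqP; split=> y.
    by move=> [yb xy] [_|i im]; [rewrite yb|rewrite /= xy].
  by move=> xy; split=> [|i im]; [rewrite /head_set /= -xy|exact: (xy i.+1)].
rewrite !measure_cyl -EFinM big_ord_recl /= x0; congr (_%:E).
by rewrite mulrCA; congr (_ * (_ * _)); apply: eq_bigr.
Qed.

(** Markov property: both sides are finite measures in [C] that agree on cylinders, a generating
    class closed under intersection. *)
Lemma measure_transition a b (C : set (borel X)) : measurable C ->
  mu (head_set b `&` T @^-1` (C `&` head_set a)) =
  ((A a b)%:E * mu (C `&` head_set a))%E.
Proof.
have Aab0 : 0 <= A a b by case: A_stoch.
have mD : measurable (T @^-1` head_set a `&` head_set b).
  apply: measurableI; last exact: measurable_head.
  by rewrite -[X in measurable X]setTI; apply: mT => //; exact: measurable_head.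
pose m1 : {measure set (borel X) -> \bar R} :=
  measure_function_pushforward__canonical__measure_function_Measure
    (mrestr mu mD) mT.
pose m2 : {measure set (borel X) -> \bar R} :=
  mscale (NngNum Aab0) (mrestr mu (measurable_head a)).
move=> mC; transitivity (m1 C).
  rewrite /m1 /= /pushforward /mrestr /=; congr (mu _).
  by rewrite setIC preimage_setI setIA.
transitivity (m2 C); last by [].
apply: (measure_unique cylinders (fun=> setT)) mC.
- exact: sigma_cylinders.
- exact: setI_closed_cylinders.
- by move=> _; right; exists 0%N, point; apply/seteqP; split.
- by apply/seteqP; split=> // x _; exists 0%N.
- move=> B GB; transitivity ((A a b)%:E * mu (B `&` head_set a))%E; last by [].
  rewrite /m1 /= /pushforward /mrestr /=.
  rewrite setIA -preimage_setI setIC.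
  case: GB => [->|[n [x ->]]].
    by rewrite set0I preimage_set0 setI0 !measure0 mule0.
  have [[z [xz za]]|nz] := pselect (cyl n x `&` head_set a !=set0); last first.
    have -> : cyl n x `&` head_set a = set0.
      by apply/seteqP; split=> // z zP; apply: nz; exists z.
    by rewrite preimage_set0 setI0 !measure0 mule0.
  (* The length is raised to at least 1, so that the cylinder fixes the head even when [n] is 0. *)
  have -> : cyl n x `&` head_set a = cyl (maxn n 1).-1.+1 z.
    rewrite prednK ?leq_max ?orbT //; apply/seteqP; split=> y.
      move=> [xy ya] i; rewrite leq_max ltnS leqn0 => /orP[ni|/eqP->].
        by rewrite -xz // xy.
      by rewrite za ya.
    move=> zy; split=> [i ni|]; first by rewrite xz // zy // leq_max ni.
    by rewrite /head_set /= -zy ?leq_max ?orbT.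
  exact: measure_transition_cyl.
- move=> _; rewrite /m1 /= /pushforward /mrestr.
  apply: le_lt_trans (probability_le1 mu _) (ltry _).
  by rewrite preimage_setT setTI.
Qed.

(** On points with head [a], the kernel of [head_set b] and the constant [A a b] have equal
    integrals over every measurable subset, hence agree almost everywhere. *)
Lemma kernel_head (k : R.-pker (borel X) ~> (borel X)) :
  fibre_probability mu T k ->
  {ae mu, forall x : borel X, forall b, k x (head_set b) = (A (x 0%N) b)%:E}.
Proof.
move=> kP.
suff H : {ae mu, forall x : borel X, forall b a,
    head_set a x -> k x (head_set b) = (A a b)%:E}.
  by apply: filterS H => x H b; exact: H.
apply: filter_forall => b; apply: filter_forall => a.
have H := @integral_ae_eq _ _ _ mu (head_set a) (measurable_head a)
  (k ^~ (head_set b)) (EFin \o cst (A a b)).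
have : ae_eq mu (head_set a) (EFin \o cst (A a b)) (k ^~ (head_set b)).
  apply: H.
  - by apply: finite_measure_integrable_cst; exact: measurable_head.
  - apply: (@measurable_funTS _ _ _ _ (head_set a)).
    by apply: measurable_kernel; exact: measurable_head.
  - move=> E Ea mE; rewrite -kP //; last exact: measurable_head.
    have -> : (\int[mu]_(x in E) (EFin \o cst (A a b)) x = (A a b)%:E * mu E)%E.
      exact: (integral_cst mu mE (A a b)%:E).
    rewrite -{2}(setIidl Ea) measure_transition //.
    by rewrite setIidl.
by apply: filterS => x Hx xa; rewrite -Hx.
Qed.

(** A forbidden transition between coordinates 1 and 0 defines a null cylinder of length 2;
    invariance of the measure carries this to all coordinates. *)
Lemma ae_admissible :
  {ae mu, forall x : borel X, forall i, A (x i.+1) (x i) != 0}.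
Proof.
have shift (P : borel X -> Prop) :
    {ae mu, forall x, P x} -> {ae mu, forall x, P (T x)}.
  move=> [Z [mZ Z0 PZ]]; exists (T @^-1` Z); split.
  - by rewrite -[X in measurable X]setTI; exact: mT.
  - by rewrite T_inv.
  - by move=> x /= nP; apply: PZ.
apply: ae_foralln; elim=> [|i IH]; last first.
  exact: (shift (fun x => A (x i.+1) (x i) != 0)).
suff : {ae mu, forall x : borel X, forall a b,
    A a b = 0 -> ~ (x 0%N = b /\ x 1%N = a)}.
  by apply: filterS => x H; apply/eqP => /H; apply.
apply: filter_forall => a; apply: filter_forall => b.
have [Aab|nAab] := eqVneq (A a b) 0; last first.
  by apply: nearW => x Aab; rewrite Aab eqxx in nAab.
pose z : X := prepend b (fun=> a).
exists (cyl 2 z); split; first exact: measurable_cyl.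
  by rewrite measure_cyl big_ord1 /z /= Aab mulr0.
move=> x /= /not_implyP[_ /contrapT[xb xa]] [|[|//]] _ /=; by rewrite ?xb ?xa.
Qed.

(** The cylinder of an admissible [z] has positive measure, so by mixing it meets the event of being
    in state [a] at every large time. There are finitely many states, so one [K] serves them all;
    this supplies the common word at a common depth. *)
Lemma mixing_connection l : strongly_mixing mu T ->
  exists K (z : X), (l <= K)%N /\ forall a, exists w : X,
    [/\ forall i, A (w i.+1) (w i) != 0, w K = a & agree l z w].
Proof.
move=> mix; have [z zadm] : exists z : X, forall i, A (z i.+1) (z i) != 0.
  have aeF : ProperFilter (almost_everywhere mu).
    apply: (ae_properfilter_algebraOfSetsType (mu := mu)).
    have mu1 : mu setT = 1%E := probability_setT mu.
    by apply: (@lt_le_trans _ _ 1%E); [exact: lte01|rewrite -mu1].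
  exact: (@filter_ex _ _ aeF _ ae_admissible).
have [q0 _ _] := q_stat.
have Bpos : (0 < mu (cyl l.+1 z))%E.
  rewrite measure_cyl lte_fin mulr_gt0 // prodr_gt0 // => i _.
  by rewrite lt_neqAle eq_sym zadm; case: A_stoch => ->.
have ev a : \forall n \near \oo,
    mu (iter n T @^-1` head_set a `&` cyl l.+1 z) != 0%E.
  have := mix (head_set a) (cyl l.+1 z) (measurable_head a) (measurable_cyl _ _).
  move: Bpos; rewrite measure_head measure_cyl -EFinM.
  set c := q ord0 (z l) * _; rewrite lte_fin => c0.
  have qc0 : 0 < q ord0 a * c by rewrite mulr_gt0.
  move=> /fine_cvgP[_] /cvgrPdist_lt /(_ _ qc0); apply: filterS => n /= Hn.
  by apply/eqP => E0; move: Hn; rewrite E0 subr0 gtr0_norm // ltxx.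
have [K _ KP] : \forall n \near \oo, forall a,
    mu (iter n T @^-1` head_set a `&` cyl l.+1 z) != 0%E.
  exact: filter_forall.
exists (maxn K l), z; split=> [|a]; first exact: leq_maxr.
have := KP (maxn K l) (leq_maxl _ _) a.
set S := _ `&` _ => S0.
(* A set of nonzero measure contains an admissible point. *)
have [w [Sw wadm]] : exists w, S w /\ forall i, A (w i.+1) (w i) != 0.
  apply: contrapT => nw; move/eqP: S0; apply.
  have mTn n B : measurable B -> measurable (iter n T @^-1` B).
    elim: n B => // n IH B mB.
    rewrite (_ : _ @^-1` _ = iter n T @^-1` (T @^-1` B)) //.
    by apply: IH; rewrite -[X in measurable X]setTI; exact: mT.
  have mS : measurable S.
    apply: measurableI; last exact: measurable_cyl.
    by apply: mTn; exact: measurable_head.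
  apply/negligibleP => //; apply: negligibleS ae_admissible => w Sw /= wadm.
  by apply: nw; exists w.
have iterT n (x : borel X) j : iter n T x j = x (j + n)%N.
  by elim: n x j => [|n IH] x j; rewrite ?addn0 //= /past_shift IH addSnnS.
exists w; split=> //.
  by case: Sw => + _; rewrite /head_set /= iterT.
by case: Sw => _ zw; apply: agreeW zw.
Qed.

(** * Preimage trees of the Markov shift *)

Variable p : nat.
Hypothesis p_gt0 : (0 < p)%N.
Local Notation unif := (fun _ : 'I_p => p%:R^-1 : R).

(** A description of the fibre free of the kernel: the heads of the preimages are, without
    repetition, the states reachable from the head of [x]. *)
Definition lists_preimages (x : X) (e : 'I_p -> X) : Prop :=
  [/\ forall j, T (e j) = x, injective (fun j => e j 0%N) &
      forall b, A (x 0%N) b != 0 <-> exists j, e j 0%N = b].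

Lemma preimage_eq (x y z : X) : T y = z -> T x = z -> x 0%N = y 0%N -> x = y.
Proof.
by move=> <- xy e0; apply/funext => -[|i] //; exact: (congr1 (@^~ i) xy).
Qed.

(** A preimage is determined by its head, so heads are distinct. The mass [A (x 0) b] of head [b] is
    [1/p] times the number of listed preimages with that head. *)
Lemma fibre_listing_preimages (X0 : set (borel X))
    (k : R.-pker borel X ~> borel X) (x : borel X) (e : 'I_p -> borel X) :
  (forall b, k x (head_set b) = (A (x 0%N) b)%:E) ->
  fibre_listing T unif X0 k x e -> lists_preimages x e.
Proof.
move=> kA le; have [einj erng _] := le.
have Te j : T (e j) = x.
  have : range e (e j) by exists j.
  by rewrite erng => -[].
have hinj : injective (fun j => e j 0%N).
  by move=> i j eij; apply: einj; exact: preimage_eq (Te j) (Te i) eij.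
split=> // b; have := kA b.
rewrite (fibre_listing_kernel measurable_point p_gt0 le (measurable_head b)).
case=> <-; split=> [|[j eb]].
  apply: contra_neqP => nb; apply: big1 => j _.
  by rewrite indicE memNset ?mulr0 // => eb; apply: nb; exists j.
have pV0 : 0 < (p%:R^-1 : R) by rewrite invr_gt0 ltr0n.
rewrite gt_eqF // (bigD1 j) //= ltr_pwDl //.
  by rewrite indicE mem_set ?mulr1.
by apply: sumr_ge0 => i _; rewrite mulr_ge0 // ltW.
Qed.

(** Basis of an explicit tree partition: a preimage is labelled by the rank of its head among the
    successors of the next state. On the branches of a point whose head has exactly [p] successors,
    the default values of [nth] and [insubd] are not reached. *)
Definition succs a : seq 'I_N.+1 := enum [pred b | A a b != 0].

Definition branch (j : 'I_p) (x : borel X) : borel X :=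
  prepend (nth ord0 (succs (x 0%N)) j) x.

Definition branch_label (y : borel X) : 'I_p :=
  insubd (Ordinal p_gt0) (index (y 0%N) (succs (y 1%N))).

(** The given listing has [p] distinct heads, which are exactly the successors, so [branch] merely
    reorders it. *)
Lemma tree_partition_exists : p_to_one mu T unif ->
  tree_partition mu T unif branch_label branch.
Proof.
move=> [X0 [k [mX0 X01 kP ke]]]; split.
  move=> j; apply: (@measurable_agree _ 2) => x y xy.
  by rewrite /branch_label /= !xy.
exists X0, k; split=> //.
apply: (filterS2 _ _ (kernel_head kP) ke) => x kA [e le].
have [Te hinj succP] := fibre_listing_preimages kA le.
have [einj erng ke1] := le.
set s := succs (x 0%N).
have us : uniq s by exact: enum_uniq.
have sE b : (b \in s) = (A (x 0%N) b != 0) by rewrite mem_enum.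
have ss : size s = p.
  rewrite -[RHS]card_ord -(card_codom hinj) /s /succs -cardE; apply: eq_card => b.
  rewrite !inE; apply/idP/idP => [/succP[j <-]|/codomP[j ->]].
    exact: codom_f.
  by apply/succP; exists j.
have bE j : exists i, branch j x = e i.
  have /succP[i ei] : A (x 0%N) (nth ord0 s j) != 0.
    by rewrite -sE mem_nth // ss.
  exists i; apply: (@preimage_eq _ _ x) => //; exact: Te.
split; last first.
  move=> j; apply: val_inj; rewrite /branch_label /= -/s index_uniq ?ss //.
  by rewrite val_insubd ltn_ord.
split=> [i j /(congr1 (@^~ 0%N)) /= /eqP||j]; last first.
- by have [i ->] := bE j.
- rewrite -erng; apply/seteqP; split=> [_ [j _ <-]|_ [i _ <-]].
    by have [i ->] := bE j; exists i.
  have es : e i 0%N \in s by rewrite sE; apply/succP; exists i.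
  have ip : (index (e i 0%N) s < p)%N by rewrite -ss index_mem.
  exists (Ordinal ip) => //; apply: (@preimage_eq _ _ x) => //.
  by rewrite /= nth_index.
- by rewrite nth_uniq ?ss // => /eqP /val_inj.
Qed.

Section PreimageTrees.
Variable br : 'I_p -> borel X -> borel X.
Variable D : set (borel X).
Hypothesis D_branch : forall x v, D x -> D (foldr br x v).
Hypothesis D_lists : forall x, D x -> lists_preimages x (br^~ x).

(** Every admissible word arriving from the head of [x] is spelled by a node of the tree over [x]:
    each earlier coordinate is a successor, hence the head of a child. The bound [K.+1] includes the
    coordinate of [x] itself. *)
Lemma follow_path K (x w : borel X) : D x ->
  (forall i, A (w i.+1) (w i) != 0) -> w K = x 0%N ->
  exists2 u, size u = K & agree K.+1 w (foldr br x u).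
Proof.
elim: K w => [|K IH] w Dx wadm wK; first by exists [::] => // -[].
have [u su uw] := IH (T w) Dx (fun i => wadm i.+1) wK.
have [Tb _ succP] := D_lists (D_branch u Dx).
have := wadm 0%N; rewrite (uw 0%N isT : w 1%N = _) => /succP[j wj].
exists (j :: u); first by rewrite /= su.
case=> // i iK /=; rewrite -[LHS]/(T w i) uw //.
exact: (esym (congr1 (@^~ i) (Tb j))).
Qed.

(** Words of length [l.+1] contain the head, which determines the heads of the children; children
    with equal heads are paired. *)
Lemma siblings_perm l (x y : borel X) : D x -> D y -> agree l.+1 x y ->
  exists pi : 'S_p, forall j, agree l.+1 (br j x) (br (pi j) y).
Proof.
move=> /D_lists[Tx xinj xP] /D_lists[Ty yinj yP] xy.
have /choice[f fP] : forall j, exists i, br i y 0%N = br j x 0%N.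
  by move=> j; apply/yP; rewrite -xy //; apply/xP; exists j.
have finj : injective f.
  by move=> i j fij; apply: xinj; rewrite -!fP fij.
exists (perm finj) => j; rewrite permE; case=> [_|i il]; first by rewrite fP.
rewrite (congr1 (@^~ i) (Tx j) : br j x i.+1 = _).
by rewrite (congr1 (@^~ i) (Ty (f j)) : br (f j) y i.+1 = _) xy // ltnW.
Qed.

(** Words as finite sequences have decidable equality, as the labels in [matching] must. *)
Lemma agreeP l (x y : X) : reflect (agree l x y) (mkseq x l == mkseq y l).
Proof.
apply: (iffP eqP) => [xy i il|xy].
  by rewrite -(nth_mkseq ord0 x il) xy nth_mkseq.
apply: (@eq_from_nth _ ord0); rewrite ?size_mkseq // => i il.
by rewrite !nth_mkseq ?xy.
Qed.

(** The label of a node is its word of length [l.+1]. The bound depends on [l] through [K], but not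
    on [x], [y] or [n]. *)
Lemma tree_matching l : strongly_mixing mu T ->
  exists C : R, forall x y, D x -> D y -> exists pi, forall n,
    \sum_(m < n) \sum_(v : m.-tuple 'I_p) p%:R^-1 ^+ m *
      (mkseq (foldr br x v) l.+1 != mkseq (foldr br y (twist pi v)) l.+1)%:R <= C.
Proof.
move=> /(mixing_connection l.+1)[K [z [lK conn]]].
exists (toll p K)%:R => x y Dx Dy.
apply: (matching R p_gt0 (K := K)
  (tau := fun v => mkseq (foldr br x v) l.+1)
  (tau' := fun v => mkseq (foldr br y v) l.+1)).
  have reach x' v : D x' -> exists2 u, size u = K &
      agree l.+1 z (foldr br x' (u ++ v)).
    move=> Dx'; have [w [wadm wK zw]] := conn (foldr br x' v 0%N).
    have [u su uw] := follow_path (D_branch v Dx') wadm wK.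
    exists u => // i il; rewrite foldr_cat -uw ?zw // (leq_trans il) //.
    exact: leqW.
  move=> v v'; have [u su uz] := reach x v Dx; have [u' su' uz'] := reach y v' Dy.
  exists u, u'; split=> //; apply/eqP/agreeP => i il.
  by rewrite -uz // -uz'.
move=> v v' /eqP /agreeP vv'.
have [pi piP] := siblings_perm (D_branch v Dx) (D_branch v' Dy) vv'.
by exists pi => j; apply/eqP/agreeP; exact: piP.
Qed.

End PreimageTrees.

End MarkovChain.

(** * Estimate of [tbar] and conclusion *)

Lemma tbar_le (R : realType) (p : nat) (M : metricType R) n
    (h h' : seq 'I_p -> M) (B : seq 'I_p -> seq 'I_p) :
  tree_automorphism (fun=> p%:R^-1 : R) B ->
  tbar (fun=> p%:R^-1 : R) n h h' <= n%:R^-1 * \sum_(1 <= m < n.+1)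
    \sum_(v : m.-tuple 'I_p) p%:R^-1 ^+ m * mdist (h v) (h' (B v)).
Proof.
move=> autB; rewrite /tbar ler_wpM2l ?invr_ge0 //; apply: ge_inf.
  exists 0 => _ [B' _ ->]; apply: sumr_ge0 => m _; apply: sumr_ge0 => v _.
  by rewrite mulr_ge0 ?mdist_ge0 // weight_unif exprn_ge0 ?invr_ge0.
exists B => //; apply: eq_bigr => m _; apply: eq_bigr => v _.
by rewrite weight_unif size_tuple.
Qed.

Lemma sum_unif (R : realType) (p m : nat) : (0 < p)%N ->
  \sum_(v : m.-tuple 'I_p) p%:R^-1 ^+ m = 1 :> R.
Proof.
move=> p0; rewrite sumr_const card_tuple card_ord -[LHS]mulr_natr natrX -exprMn.
by rewrite mulVf ?expr1n // pnatr_eq0 -lt0n.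
Qed.

Theorem proposition4p1p1 (R : realType) (p : nat) (p_gt0 : (0 < p)%N)
    (N : nat) (A : 'M[R]_N.+1) (A_stoch : stochastic A)
    (A_irr : irreducible_matrix A)
    (mu : probability (borel (past_seq N)) R) (mu_markov : markov_measure A mu)
    (T_endo : p_endomorphism mu (@past_shift N) (fun _ : 'I_p => p%:R^-1))
    (T_mixing : strongly_mixing mu (@past_shift N)) :
  tvwB mu (@past_shift N) (fun _ : 'I_p => p%:R^-1).
Proof.
case: mu_markov => q q_stat mu_cyl.
case: T_endo => -[_ _ _ mT T_inv] T_to_one _.
move=> M g cM mg; split.
  exists (branch_label A p_gt0), (@branch _ _ A p).
  exact: (tree_partition_exists A_stoch mT mu_cyl p_gt0 T_to_one).
move=> K br [mK [X0 [k [mX0 X01 kP brP]]]] eps eps0.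
(* Quantifying over all nodes makes [D] stable under the branches; it still has full measure by
   [ae_branch]. *)
pose D := [set x | forall v,
  lists_preimages A (foldr br x v) (br^~ (foldr br x v))].
have aeP : {ae mu, forall x, lists_preimages A x (br^~ x)}.
  apply: (filterS2 _ _ (kernel_head A_stoch mT mu_cyl kP) brP) => x kA [le _].
  exact: (fibre_listing_preimages p_gt0 kA le).
have aeD : {ae mu, forall x, D x}.
  exact: (ae_branch (@measurable_point N) p_gt0 kP mK brP aeP).
have D_branch x v : D x -> D (foldr br x v).
  by move=> Dx u; rewrite -foldr_cat.
have D_lists x : D x -> lists_preimages A x (br^~ x) by move=> /(_ [::]).
have [c c0 cP] := mdist_bounded (g point) cM.
(* Error budget over [n] levels: [n * e] from matched nodes, [c * (2 * n * delta) = n * e] from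
   visits to [E] in both trees, and [c * C < n * e] from mismatches; together less than
   [n * eps]. *)
pose e := eps / 4; have e0 : 0 < e by rewrite divr_gt0.
pose delta := e / (c *+ 2); have d0 : 0 < delta by rewrite divr_gt0 // mulrn_wgt0.
(* With measure at most [eps * delta] for [E], the set excluded by [rarely_visiting] has measure at
   most [eps]. *)
have [l [E [mE muE gE]]] :=
  almost_uniformly_local mu e0 (mulr_gt0 eps0 d0) cM mg.
have [C CP] := tree_matching A_stoch q_stat mT T_inv mu_cyl p_gt0
  D_branch D_lists l T_mixing.
exists (Num.truncn (c * C / e)).+1 => n nN.
have n0 : (0 < n)%N by exact: leq_ltn_trans nN.
have [G [mG muG GP]] := rarely_visiting (@measurable_point N) p_gt0 kP mK brP
  aeD mE n0 d0.
exists G; split=> //.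
  apply: le_trans muG; rewrite lee_fin lerD2l lerN2 ler_pdivrMr //.
  by rewrite -lee_fin fineK // fin_num_measure.
move=> x y /GP[Dx xE] /GP[Dy yE].
have [pi piP] := CP x y Dx Dy.
apply: le_lt_trans (tbar_le _ _ _ (twist_automorphism R pi)) _.
have nR : 0 < n%:R :> R by rewrite ltr0n.
rewrite mulrC ltr_pdivrMr //.
pose w m : R := p%:R^-1 ^+ m.
pose mis (v : seq 'I_p) : R :=
  (mkseq (foldr br x v) l.+1 != mkseq (foldr br y (twist pi v)) l.+1)%:R.
(* A pair of nodes costs less than [e] unless one of the two lies in [E] or their words differ; in
   these cases it costs at most the diameter bound [c]. *)
have bound : \sum_(1 <= m < n.+1) \sum_(v : m.-tuple 'I_p)
      w m * mdist (g (foldr br x v)) (g (foldr br y (twist pi v))) <=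
    \sum_(1 <= m < n.+1) \sum_(v : m.-tuple 'I_p) (w m * e +
      c * (w m * \1_E (foldr br x v) + w m * \1_E (foldr br y (twist pi v)) +
           w m * mis v)).
  apply: ler_sum => m _; apply: ler_sum => v _.
  rewrite -!mulrDr (mulrCA c) -mulrDr ler_wpM2l ?exprn_ge0 ?invr_ge0 //.
  rewrite !indicE.
  have [xvE|xvE] := boolP (foldr br x v \in E).
    rewrite (le_trans (cP _ _)) // -addrA mulrDr mulr1 addrCA lerDl.
    by rewrite addr_ge0 ?(ltW e0) // mulr_ge0 ?addr_ge0 // ltW.
  have [yvE|yvE] := boolP (foldr br y (twist pi v) \in E).
    rewrite (le_trans (cP _ _)) // add0r mulrDr mulr1 addrCA lerDl.
    by rewrite addr_ge0 ?(ltW e0) // mulr_ge0 // ltW.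
  rewrite !add0r /mis; case: (agreeP l.+1 (foldr br x v)) => [xy|_] /=.
    rewrite mulr0 addr0 ltW // gE //.
    - by move=> /mem_set; exact/negP.
    - by move=> /mem_set; exact/negP.
    - exact: agreeW xy.
  by rewrite mulr1 (le_trans (cP _ _)) // lerDr ltW.
apply: le_lt_trans bound _.
(* [twist pi] permutes each level, so the visits of the matched nodes over [y] are counted as those
   of all nodes over [y]. *)
under eq_bigr => m _ do rewrite big_split /= -mulr_suml sum_unif // mul1r
  -mulr_sumr !big_split /= (sum_tuple_twist (fun v => w m * \1_E (foldr br y v))).
rewrite big_split /= sumr_const_nat subn1 /= -mulr_sumr !big_split /=.
(* The bound from the matching also counts the root level, whose nonnegative term is dropped. *)
have mism : \sum_(1 <= m < n.+1) \sum_(v : m.-tuple 'I_p) w m * mis v <= C.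
  apply: le_trans (piP n.+1); rewrite -(big_mkord xpredT (fun m =>
    \sum_(v : m.-tuple 'I_p) w m * mis v)) [leRHS]big_ltn // lerDr.
  by apply: sumr_ge0 => v _; rewrite mulr_ge0 ?exprn_ge0 ?invr_ge0.
have cC : c * C < n%:R * e.
  rewrite -ltr_pdivrMr //; apply: lt_le_trans (truncnS_gt _) _.
  by rewrite ler_nat.
move: xE yE mism; rewrite /w.
set a := \sum_(_ <= _ < _) _; set b := \sum_(_ <= _ < _) _.
set m := \sum_(_ <= _ < _) _ => ax bx mx.
have dc : c * delta = e / 2.
  by rewrite /delta -mulr_natr; field; rewrite gt_eqF.
have nd : c * (n%:R * delta) = n%:R * e / 2 by rewrite mulrCA dc mulrA.
have ne : eps * n%:R = n%:R * e * 4 by rewrite /e; field.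
have : c * (a + b + m) <= c * (n%:R * delta + n%:R * delta + C).
  by rewrite ler_wpM2l ?(ltW c0) // !lerD.
have ne0 : 0 < n%:R * e by rewrite mulr_gt0.
rewrite [in leRHS]mulrDr [in leRHS]mulrDr nd ne -[e *+ n]mulr_natl; lra.
Qed.
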